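(* In the trilevel setting, let $\Omega:=\{x\in\mathrm{Fix}(W):\langle (I-T)x,y-x\rangle\ge0\ \forall y\in\mathrm{Fix}(W)\}$ be nonempty. Assume $\lim_{k\to\infty}\beta_k/\alpha_k=+\infty$, $\alpha_k\to0$, $\sum_k\alpha_k=\infty$, there is $K>0$ with $\limsup_{k}\frac1{\alpha_k}\left|\frac1{\beta_k}-\frac1{\beta_{k-1}}\right|\le K$, $\limsup_{k}\frac{|\beta_k-\beta_{k-1}|+|\alpha_k-\alpha_{k-1}|}{\alpha_k\beta_k}=0$, and that the trilevel iteration sequence $\{x^k\}$ is bounded. Suppose further: $(A_1)$ $W$ is boundedly linearly regular, i.e. for every $\rho>0$ there is $\theta>0$ with $d(x,\mathrm{Fix}(W))\le\theta\|x-W(x)\|$ for all $x$ with $\|x\|\le\rho$; $(A_2)$ $\limsup_{k\to\infty}\beta_k^2/\alpha_k=0$. Then $\{x^k\}$ converges to the unique $x^*\in\Omega$ satisfying $\langle x^*-S(x^* ),x-x^*\rangle\ge0$ for all $x\in\Omega$; equivalently $\omega(x^* )=\min_{x\in\Omega}\omega(x)$.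
   Context: Trilevel setting. Let $f_1,f_2:\mathbb R^n\to\mathbb R$ be convex and continuously differentiable with $L_{f_i}$-Lipschitz gradients, and $g_1,g_2:\mathbb R^n\to(-\infty,+\infty]$ proper, lower semicontinuous and convex; put $\phi_i=f_i+g_i$. Let $\omega:\mathbb R^n\to\mathbb R$ be $\mu$-strongly convex and continuously differentiable with $L_\omega$-Lipschitz gradient. Let $Y^*=\arg\min_{x\in\mathbb R^n}\phi_2(x)$ and $X^*=\arg\min_{x\in Y^*}\phi_1(x)$, both assumed nonempty. For a proper lsc convex $g$, $\mathrm{prox}_g(x)=\arg\min_{u}\{g(u)+\tfrac12\|u-x\|^2\}$. Fix $u\in(0,\tfrac{2}{L_\omega+\mu}]$, $t\in(0,1/L_{f_1}]$, $s\in(0,1/L_{f_2}]$ and define $S(x)=x-u\nabla\omega(x)$, $T(x)=\mathrm{prox}_{tg_1}(x-t\nabla f_1(x))$, $W(x)=\mathrm{prox}_{sg_2}(x-s\nabla f_2(x))$. Then $S$ is a contraction with constant $r=\sqrt{1-\tfrac{2u\mu L_\omega}{\mu+L_\omega}}\in[0,1)$, $T,W$ are nonexpansive, $\mathrm{Fix}(W)=Y^*$. Given $x^0\in\mathbb R^n$ and real sequences $\alpha_k,\beta_k\in(0,1)$, the trilevel iteration sequence is $x^{k+1}=\alpha_kS(x^k)+(1-\alpha_k)\beta_kT(x^k)+(1-\alpha_k)(1-\beta_k)W(x^k)$, $k\ge0$. $I$ is the identity, $d(x,A)=\inf_{a\in A}\|x-a\|$. *)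

(* Defs.v *)
From HB Require Import structures.
From mathcomp Require Import all_boot all_order all_algebra.
From mathcomp Require Import all_classical all_reals all_analysis.
Set Implicit Arguments. Unset Strict Implicit. Unset Printing Implicit Defensive.
Import Order.TTheory GRing.Theory Num.Theory.
Import numFieldNormedType.Exports.
Local Open Scope classical_set_scope.
Local Open Scope ring_scope.

Section Defs.
Variables (R : realType) (n : nat).
Notation V := 'rV[R]_n.

Definition dotp (u v : V) : R := \sum_(i < n) u ord0 i * v ord0 i.
Definition enorm (u : V) : R := Num.sqrt (dotp u u).

Definition vdist (x : V) (A : set V) : R := inf [set enorm (x - a) | a in A].

Definition has_gradient (f : V -> R) (gf : V -> V) : Prop :=
  forall x, differentiable f x /\ forall h, 'd f x h = dotp (gf x) h.

Definition lipschitz_with (F : V -> V) (L : R) : Prop :=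
  forall x y, enorm (F x - F y) <= L * enorm (x - y).

Definition convex_fun (f : V -> R) : Prop :=
  forall x y (l : R), 0 <= l <= 1 ->
    f (l *: x + (1 - l) *: y) <= l * f x + (1 - l) * f y.

Definition strongly_convex_fun (f : V -> R) (mu : R) : Prop :=
  forall x y (l : R), 0 <= l <= 1 ->
    f (l *: x + (1 - l) *: y) <=
      l * f x + (1 - l) * f y - mu / 2 * l * (1 - l) * (enorm (x - y)) ^+ 2.

Definition proper_fun (g : V -> \bar R) : Prop :=
  (exists x, g x \is a fin_num) /\ (forall x, (-oo < g x)%E).

Definition convex_efun (g : V -> \bar R) : Prop :=
  forall x y (l : R), 0 < l < 1 ->
    (g (l *: x + (1 - l) *: y)%R <= l%:E * g x + (1 - l)%R%:E * g y)%E.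

Definition is_prox (g : V -> \bar R) (x p : V) : Prop :=
  forall u, (g p + ((enorm (p - x)%R) ^+ 2 / 2)%R%:E <=
             g u + ((enorm (u - x)%R) ^+ 2 / 2)%R%:E)%E.

Definition argmin_on (A : set V) (phi : V -> \bar R) : set V :=
  [set x | A x /\ forall y, A y -> (phi x <= phi y)%E].

Definition fixpts (F : V -> V) : set V := [set x | F x = x].

End Defs.

(* Main.v *)
Require Import Defs.
From HB Require Import structures.
From mathcomp Require Import all_boot all_order all_algebra.
From mathcomp Require Import all_classical all_reals all_analysis.
From mathcomp Require Import ring lra.
Import Order.TTheory GRing.Theory Num.Theory.
Import numFieldNormedType.Exports.
Local Open Scope classical_set_scope.
Local Open Scope ring_scope.
Set Implicit Arguments. Unset Strict Implicit. Unset Printing Implicit Defensive.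

(* S is a contraction because its gradient is both cocoercive (Baillon-Haddad)
   and strongly monotone. Omega is convex by Minty's reformulation of its
   variational inequality, so the minimiser xs of om over Omega satisfies the
   inequality for I - S. Along the iteration, the variation hypotheses and Xu's
   lemma applied twice give |x_(k+1) - x_k| = o(beta_k), hence
   |x_k - W x_k| = O(beta_k), and every cluster point lies in Omega. In
     |x_(k+1) - xs|^2 <= (1 - c alpha_k) |x_k - xs|^2
        + 2 alpha_k <S xs - xs, x_(k+1) - xs>
        + 2 (1 - alpha_k) beta_k <T xs - xs, x_(k+1) - xs>
   the second term is then asymptotically at most o(alpha_k), and the third one
   is at most beta_k O(d(x_(k+1), Fix W)) = O(beta_k^2) = o(alpha_k) by linear
   regularity; Xu's lemma concludes. *)

(** * Euclidean inner product, norm and compactness on row vectors *)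

Section InnerProduct.
Variables (R : realType) (n : nat).
Implicit Types (x y z h v w : 'rV[R]_n) (a l : R).

Lemma dotpC x y : dotp x y = dotp y x.
Proof. by apply: eq_bigr => i _; rewrite mulrC. Qed.

Lemma dotpDl x y z : dotp (x + y) z = dotp x z + dotp y z.
Proof. by rewrite -big_split; apply: eq_bigr => i _; rewrite mxE mulrDl. Qed.

Lemma dotpZl a x y : dotp (a *: x) y = a * dotp x y.
Proof. by rewrite /dotp mulr_sumr; apply: eq_bigr => i _; rewrite mxE mulrA. Qed.

Lemma dotpNl x y : dotp (- x) y = - dotp x y.
Proof. by rewrite -scaleN1r dotpZl mulN1r. Qed.

Lemma dotpDr x y z : dotp x (y + z) = dotp x y + dotp x z.
Proof. by rewrite !(dotpC x) dotpDl. Qed.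

Lemma dotpZr a x y : dotp x (a *: y) = a * dotp x y.
Proof. by rewrite !(dotpC x) dotpZl. Qed.

Lemma dotpNr x y : dotp x (- y) = - dotp x y.
Proof. by rewrite !(dotpC x) dotpNl. Qed.

Definition dotpE := (dotpDl, dotpDr, dotpNl, dotpNr, dotpZl, dotpZr).

Lemma dotp_ge0 x : 0 <= dotp x x.
Proof. by apply: sumr_ge0 => i _; rewrite -expr2 sqr_ge0. Qed.

Lemma enorm_ge0 x : 0 <= enorm x.
Proof. exact: sqrtr_ge0. Qed.

Lemma enorm_sqr x : enorm x ^+ 2 = dotp x x.
Proof. by rewrite sqr_sqrtr ?dotp_ge0. Qed.

Lemma coord_le_enorm x i : `|x ord0 i| <= enorm x.
Proof.
rewrite -(@ler_pXn2r _ 2) ?nnegrE ?enorm_ge0// enorm_sqr real_normK ?num_real//.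
rewrite /dotp (bigD1 i)//= -expr2 lerDl.
by apply: sumr_ge0 => j _; rewrite -expr2 sqr_ge0.
Qed.

Lemma enorm_eq0 x : enorm x = 0 -> x = 0.
Proof.
move=> x0; apply/rowP => i; rewrite mxE; apply/normr0_eq0/eqP.
by rewrite eq_le normr_ge0 andbT -x0 coord_le_enorm.
Qed.

Lemma enorm0 : enorm (0 : 'rV[R]_n) = 0.
Proof. by rewrite /enorm -(scale0r 0) dotpZl mul0r sqrtr0. Qed.

Lemma enormZ a x : enorm (a *: x) = `|a| * enorm x.
Proof. by rewrite /enorm !dotpE mulrA sqrtrM ?sqr_ge0// -expr2 sqrtr_sqr. Qed.

Lemma enormN x : enorm (- x) = enorm x.
Proof. by rewrite -scaleN1r enormZ normrN1 mul1r. Qed.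

Lemma enormBC x y : enorm (x - y) = enorm (y - x).
Proof. by rewrite -opprB enormN. Qed.

Lemma enorm_le x a : 0 <= a -> dotp x x <= a ^+ 2 -> enorm x <= a.
Proof.
by move=> a0; rewrite -enorm_sqr ler_pXn2r// nnegrE ?enorm_ge0.
Qed.

Lemma dotp_le_enorm x y : dotp x y <= enorm x * enorm y.
Proof.
have [y0|y0] := eqVneq (enorm y) 0.
  have -> : y = 0 *: y by rewrite scale0r; apply: enorm_eq0.
  by rewrite dotpZr enormZ normr0 !mul0r mulr0.
have yp : 0 < enorm y by rewrite lt0r y0 enorm_ge0.
have [x0|x0] := eqVneq (enorm x) 0.
  have -> : x = 0 *: x by rewrite scale0r; apply: enorm_eq0.
  by rewrite dotpZl enormZ normr0 !mul0r.
have xp : 0 < enorm x by rewrite lt0r x0 enorm_ge0.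
(* Expanding this square gives twice [enorm x * enorm y] times the Cauchy-Schwarz gap. *)
have := dotp_ge0 (enorm y *: x - enorm x *: y).
rewrite !dotpE (dotpC y x) -!enorm_sqr => H.
have xy := mulr_gt0 xp yp.
rewrite -(ler_pM2l xy); nra.
Qed.

Lemma dotp_ge_Nenorm x y : - (enorm x * enorm y) <= dotp x y.
Proof. by rewrite lerNl -dotpNl -(enormN x) dotp_le_enorm. Qed.

Lemma enormD x y : enorm (x + y) <= enorm x + enorm y.
Proof.
apply: enorm_le; first by rewrite addr_ge0 ?enorm_ge0.
rewrite !dotpE (dotpC y x) -!enorm_sqr.
have := dotp_le_enorm x y; nra.
Qed.

Lemma enormB x y : enorm (x - y) <= enorm x + enorm y.
Proof. by rewrite -(enormN y) enormD. Qed.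

(** The right side exceeds the left by exactly [dotp y y]. *)
Lemma enormD_sqr_le x y :
  enorm (x + y) ^+ 2 <= enorm x ^+ 2 + 2 * dotp y (x + y).
Proof.
rewrite !enorm_sqr !dotpE (dotpC y x); have := dotp_ge0 y; lra.
Qed.

Lemma enorm_convex_comb l x y :
  enorm (l *: x + (1 - l) *: y) ^+ 2 =
  l * enorm x ^+ 2 + (1 - l) * enorm y ^+ 2 - l * (1 - l) * enorm (x - y) ^+ 2.
Proof. rewrite !enorm_sqr !dotpE (dotpC y x); ring. Qed.

(** The ambient topology is that of the sup norm. Radius [e / n.+1] suffices since
    [n / (n+1)^2 < 1], also for [n = 0]. *)
Lemma ball_enorm x (e : R) : 0 < e -> \forall z \near x, enorm (z - x) < e.
Proof.
move=> e0; have d0 : 0 < e / n.+1%:R by rewrite divr_gt0.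
apply/nbhs_ballP; exists (e / n.+1%:R) => //= z [_ xz].
rewrite -(@ltr_pXn2r _ 2) ?nnegrE ?enorm_ge0 ?ltW// enorm_sqr.
apply: (@le_lt_trans _ _ (\sum_(i < n) (e / n.+1%:R) ^+ 2)).
  apply: ler_sum => i _; rewrite -expr2 -real_normK ?num_real//.
  rewrite ler_pXn2r ?nnegrE ?normr_ge0 ?ltW// !mxE distrC.
  exact: xz.
rewrite sumr_const card_ord -[_ *+ n]mulr_natl expr_div_n mulrCA.
rewrite -[ltRHS]mulr1 ltr_pM2l ?exprn_gt0// ltr_pdivrMr ?exprn_gt0// mul1r.
by rewrite -natrX ltr_nat (@leq_trans (n.+1))// expnS expn1 leq_pmulr.
Qed.

(** The predicate [P] selects a subsequence. The tails of that subsequence generate a proper filter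
    containing the compact box of side [[-M, M]], so the filter has a cluster point. *)
Lemma bounded_cluster_seq (x : nat -> 'rV[R]_n) M (P : nat -> Prop) :
  (forall k, enorm (x k) <= M) ->
  (forall N, exists2 k, (N <= k)%N & P k) ->
  exists p, forall (e : R) N, 0 < e ->
    exists k, [/\ (N <= k)%N, P k & enorm (x k - p) < e].
Proof.
move=> xM Pinf.
pose F : set_system 'rV[R]_n :=
  fun A => exists N, forall k, (N <= k)%N -> P k -> A (x k).
have FF : ProperFilter F.
  apply: Build_ProperFilter_ex => [A [N HN]|].
    by have [k Nk Pk] := Pinf N; exists (x k); apply: HN.
  split=> [|A B [N HN] [N' HN']|A B AB [N HN]].
  - by exists 0%N.
  - exists (maxn N N') => k; rewrite geq_max => /andP[? ?] Pk.
    by split; [apply: HN|apply: HN'].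
  - by exists N => k Nk Pk; apply/AB/HN.
have KC := @rV_compact R n (fun=> `[- M, M]%classic) (fun=> @segment_compact R (- M) M).
have [|p [_ Fp]] := KC F FF.
  exists 0%N => k _ _ i /=; rewrite in_itv/= -ler_norml.
  exact: le_trans (coord_le_enorm _ _) (xM k).
exists p => e N e0.
have [] := Fp [set y | exists k, [/\ (N <= k)%N, P k & y = x k]] _ _ (ball_enorm p e0).
  by exists N => k Nk Pk; exists k.
by move=> _ [[k [Nk Pk ->]] xp]; exists k.
Qed.

End InnerProduct.

(** * Gradient inequalities and gradient steps for smooth convex functions *)

Section SmoothConvex.
Variables (R : realType) (n : nat).
Implicit Types (x y z h : 'rV[R]_n) (f : 'rV[R]_n -> R)
  (gf : 'rV[R]_n -> 'rV[R]_n) (mu L a l : R).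

Lemma is_derive_line f gf x h (a : R) : has_gradient f gf ->
  is_derive a 1 (fun b : R => f (x + b *: h)) (dotp (gf (x + a *: h)) h).
Proof.
move=> fgf; have [df dfE] := fgf (x + a *: h).
have quotE : (fun b : R => b^-1 *: (((fun c : R => f (x + c *: h)) \o shift a) (b *: 1) -
      f (x + a *: h))) =
    (fun b : R => b^-1 *: ((f \o shift (x + a *: h)) (b *: h) - f (x + a *: h))).
  apply/funext => b /=; congr (_ *: (f _ - _)).
  by rewrite -[b *: 1]/(b * 1) mulr1 scalerDl addrCA.
split.
  rewrite /derivable quotE; exact: diff_derivable.
by rewrite /derive quotE -dfE -deriveE.
Qed.

Lemma descent_lemma f gf L x h :
  has_gradient f gf -> lipschitz_with gf L ->
  f (x + h) <= f x + dotp (gf x) h + L / 2 * dotp h h.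
Proof.
move=> fgf gfL.
(* [psi] is [f] along the segment minus its quadratic model. By Cauchy-Schwarz and the Lipschitz
   bound its derivative is nonpositive on [[0, 1]], so the mean value theorem gives
   [psi 1 <= psi 0]. *)
pose psi (a : R) := f (x + a *: h) - (dotp (gf x) h *: a + (L / 2 * dotp h h) *: a ^+ 2).
have dpsi (a : R) : is_derive a 1 psi
    (dotp (gf (x + a *: h)) h - (dotp (gf x) h + L * dotp h h * a)).
  have := is_derive_line x h a fgf => ?.
  apply: is_derive_eq.
  rewrite /GRing.scale/=. lra.
have [|c c01 psiE] := @MVT_segment R psi _ 0 1 ler01 (fun a _ => dpsi a).
  apply: derivable_within_continuous => a _; exact: (@ex_derive _ _ _ _ _ _ _ (dpsi a)).
have c0 : 0 <= c by move: c01; rewrite in_itv/= => /andP[].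
have : dotp (gf (x + c *: h) - gf x) h <= L * dotp h h * c.
  apply: le_trans (dotp_le_enorm _ _) _.
  have := gfL (x + c *: h) x; rewrite (addrC x) addrK enormZ ger0_norm// => H.
  apply: le_trans (ler_wpM2r (enorm_ge0 h) H) _.
  by rewrite -enorm_sqr; nra.
move: psiE; rewrite /psi !scale1r !scale0r addr0 expr0n/= expr1n !scaler0 /GRing.scale/= !dotpE; lra.
Qed.

Lemma has_gradientN f gf : has_gradient f gf ->
  has_gradient (fun x => - f x) (fun x => - gf x).
Proof.
move=> fgf x; have [df dfE] := fgf x; split; first exact: differentiableN.
by move=> h; rewrite (diffN df) dotpNl -dfE.
Qed.

Lemma ascent_lemma f gf L x h :
  has_gradient f gf -> lipschitz_with gf L ->
  f x + dotp (gf x) h - L / 2 * dotp h h <= f (x + h).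
Proof.
move=> fgf gfL.
have gNL : lipschitz_with (fun x => - gf x) L.
  by move=> y z; rewrite -opprD enormN.
have := descent_lemma x h (has_gradientN fgf) gNL.
rewrite dotpNl; lra.
Qed.

(** Divide by [l] and let [l] tend to 0. This turns inequalities along a segment into first-order
    conditions throughout the proof. *)
Lemma linear_ge0_of_quadratic (p q : R) :
  (forall l, 0 < l < 1 -> 0 <= l * p + l ^+ 2 * q) -> 0 <= p.
Proof.
move=> H; rewrite leNgt; apply/negP => p0.
have d0 : 0 < 2 * (1 + `|q| - p) by have := normr_ge0 q; lra.
(* With this [l] in [(0, 1)], [l * |q| < - p / 2], hence [p + l * q < 0]. *)
pose l := - p / (2 * (1 + `|q| - p)).
have l0 : 0 < l by rewrite divr_gt0// oppr_gt0.
have lE : l * (2 * (1 + `|q| - p)) = - p by rewrite divfK// gt_eqF.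
have l1 : l < 1 by rewrite ltr_pdivrMr//; have := normr_ge0 q; lra.
have := H l; rewrite l0 l1 => /(_ isT).
have -> : l * p + l ^+ 2 * q = l * (p + l * q) by ring.
rewrite pmulr_rge0//.
have : l * q <= l * `|q| by rewrite ler_wpM2l ?ler_norm// ltW.
have := normr_ge0 q; nra.
Qed.

(** At [x + l (y - x)], strong convexity bounds [f] above and [ascent_lemma] bounds it below. The
    two differ by [l] times the desired gap, up to a term in [l ^+ 2]. *)
Lemma strongly_convex_gradient f gf mu L x y :
  strongly_convex_fun f mu -> has_gradient f gf -> lipschitz_with gf L ->
  f x + dotp (gf x) (y - x) + mu / 2 * enorm (y - x) ^+ 2 <= f y.
Proof.
move=> fmu fgf gfL; rewrite -subr_ge0.
apply: (@linear_ge0_of_quadratic _ ((mu + L) / 2 * enorm (y - x) ^+ 2)).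
move=> l /andP[l0 l1].
have := @fmu y x l; rewrite (ltW l0) (ltW l1) => /(_ isT).
have -> : l *: y + (1 - l) *: x = x + l *: (y - x).
  by rewrite scalerBl scale1r scalerBr addrCA.
have := ascent_lemma x (l *: (y - x)) fgf gfL.
rewrite !dotpZl !dotpZr -enorm_sqr; lra.
Qed.

Lemma convex_strongly_convex0 f : convex_fun f -> strongly_convex_fun f 0.
Proof. by move=> fc x y l /(fc x y); rewrite !mul0r subr0. Qed.

Lemma strongly_convex_convex f mu :
  0 <= mu -> strongly_convex_fun f mu -> convex_fun f.
Proof.
move=> mu0 fmu x y l l01; apply: le_trans (fmu x y l l01) _.
have /andP[l0 l1] := l01; rewrite lerBlDr lerDl.
by rewrite !mulr_ge0 ?subr_ge0 ?exprn_ge0 ?enorm_ge0.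
Qed.

Lemma strongly_monotone_gradient f gf mu L x y :
  strongly_convex_fun f mu -> has_gradient f gf -> lipschitz_with gf L ->
  mu * enorm (x - y) ^+ 2 <= dotp (gf x - gf y) (x - y).
Proof.
move=> fmu fgf gfL.
have := strongly_convex_gradient x y fmu fgf gfL.
have := strongly_convex_gradient y x fmu fgf gfL.
rewrite (enormBC y x) -(opprB x y) dotpNr dotpDl dotpNl; lra.
Qed.

(** Evaluate [f] at [y - L^-1 *: d], with [d] the gradient difference: the tangent at [x] bounds it
    below and a descent step from [y] bounds it above. *)
Lemma convex_gradient_lower_bound f gf L x y :
  0 < L -> convex_fun f -> has_gradient f gf -> lipschitz_with gf L ->
  f x + dotp (gf x) (y - x) + (2 * L)^-1 * enorm (gf y - gf x) ^+ 2 <= f y.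
Proof.
move=> L0 fc fgf gfL.
move dE : (gf y - gf x) => d.
have := strongly_convex_gradient x (y - L^-1 *: d) (convex_strongly_convex0 fc) fgf gfL.
have := descent_lemma y (- (L^-1 *: d)) fgf gfL.
rewrite !mul0r addr0.
have gyE : dotp (gf y) d = dotp (gf x) d + dotp d d by rewrite -dotpDl -dE [gf x + _]addrC subrK.
rewrite enorm_sqr !dotpE gyE.
have -> : L / 2 * - - (L^-1 * (L^-1 * dotp d d)) = (2 * L)^-1 * dotp d d.
  by field; rewrite gt_eqF.
have -> : L^-1 * (dotp (gf x) d + dotp d d) =
   L^-1 * dotp (gf x) d + 2 * ((2 * L)^-1 * dotp d d).
  by field; rewrite gt_eqF.
lra.
Qed.

Lemma baillon_haddad f gf L x y :
  0 < L -> convex_fun f -> has_gradient f gf -> lipschitz_with gf L ->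
  L^-1 * enorm (gf x - gf y) ^+ 2 <= dotp (gf x - gf y) (x - y).
Proof.
move=> L0 fc fgf gfL.
have := convex_gradient_lower_bound x y L0 fc fgf gfL.
have := convex_gradient_lower_bound y x L0 fc fgf gfL.
rewrite (enormBC (gf y)) -(opprB x y) dotpNr dotpDl dotpNl invfM; lra.
Qed.

Lemma gradient_step_sqr gf a x y :
  enorm ((x - a *: gf x) - (y - a *: gf y)) ^+ 2 = enorm (x - y) ^+ 2
  - 2 * a * dotp (gf x - gf y) (x - y) + a ^+ 2 * enorm (gf x - gf y) ^+ 2.
Proof.
have -> : (x - a *: gf x) - (y - a *: gf y) = (x - y) - a *: (gf x - gf y).
  by apply/rowP => i; rewrite !mxE; ring.
move: (x - y) (gf x - gf y) => d g.
by rewrite !enorm_sqr !dotpE (dotpC g d); ring.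
Qed.

Lemma gradient_step_nonexpansive f gf L a x y :
  0 < L -> convex_fun f -> has_gradient f gf -> lipschitz_with gf L ->
  0 < a <= 1 / L ->
  enorm ((x - a *: gf x) - (y - a *: gf y)) <= enorm (x - y).
Proof.
move=> L0 fc fgf gfL /andP[a0 aL].
rewrite -(@ler_pXn2r _ 2) ?nnegrE ?enorm_ge0// gradient_step_sqr.
have := baillon_haddad x y L0 fc fgf gfL.
move: aL; rewrite div1r => aL.
have := sqr_ge0 (enorm (gf x - gf y)).
move: (enorm (gf x - gf y) ^+ 2) (dotp _ _) => D P D0 PD.
have aP : a * D <= P by apply: le_trans PD; rewrite ler_wpM2r.
nra.
Qed.

(** In the expanded square, cocoercivity absorbs the term in [a ^+ 2], leaving [- a (2 - a L)] times
    the inner product, which strong monotonicity bounds. The factor [2 - a L] is positive because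
    [a (L + mu) <= 2] and [a mu > 0]. *)
Lemma gradient_step_contraction f gf mu L a :
  0 < mu -> strongly_convex_fun f mu ->
  0 < L -> has_gradient f gf -> lipschitz_with gf L -> 0 < a <= 2 / (L + mu) ->
  exists2 c, 0 < c <= 1 &
  lipschitz_with (fun x => x - a *: gf x) (1 - c).
Proof.
move=> mu0 fmu L0 fgf gfL /andP[a0 aL].
have fc := strongly_convex_convex (ltW mu0) fmu.
have aL2 : 0 < 2 - a * L.
  have := mulr_gt0 a0 mu0; move: aL; rewrite ler_pdivlMr; lra.
(* The squared norm shrinks by the factor [1 - q], and [1 - q <= (1 - q / 2) ^+ 2] removes the
   square root. Capping at 1 keeps [1 - q / 2] positive. *)
pose q := Num.min 1 (mu * (a * (2 - a * L))).
have q0 : 0 < q by rewrite lt_min ltr01 !mulr_gt0.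
have q1 : q <= 1 by rewrite ge_min lexx.
have qE : q <= mu * (a * (2 - a * L)) by rewrite ge_min lexx orbT.
exists (q / 2); first by lra.
move=> x y; rewrite -(@ler_pXn2r _ 2) ?nnegrE ?enorm_ge0//; last first.
  by rewrite mulr_ge0 ?enorm_ge0//; lra.
rewrite gradient_step_sqr exprMn.
have := baillon_haddad x y L0 fc fgf gfL.
have := strongly_monotone_gradient x y fmu fgf gfL.
rewrite ler_pdivrMl//.
have := sqr_ge0 (enorm (x - y)).
move: (enorm (gf x - gf y) ^+ 2) (enorm (x - y) ^+ 2) (dotp _ _) => D N P N0 NP DP.
have H1 : a ^+ 2 * D <= a ^+ 2 * (L * P) by rewrite ler_wpM2l// sqr_ge0.
have H2 : a * (2 - a * L) * (mu * N) <= a * (2 - a * L) * P.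
  by rewrite ler_wpM2l// mulr_ge0 ?ltW.
have H3 : q * N <= mu * (a * (2 - a * L)) * N by rewrite ler_wpM2r.
have H4 : (1 - q) * N <= (1 - q / 2) ^+ 2 * N by rewrite ler_wpM2r//; nra.
lra.
Qed.

End SmoothConvex.

(** * Proximal maps and nonexpansiveness of proximal gradient steps *)

Section Prox.
Variables (R : realType) (n : nat).
Implicit Types (x y z p q v : 'rV[R]_n) (g : 'rV[R]_n -> \bar R).

Lemma proper_funZ (t : R) g : 0 < t -> proper_fun g ->
  proper_fun (fun y => t%:E * g y)%E.
Proof.
move=> t0 [[x gx] gNy]; split.
  by exists x; rewrite fin_numM.
move=> y; have := gNy y; case: (g y) => [r||]//= _; first by rewrite -EFinM ltNyr.
by rewrite gt0_muley ?lte_fin.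
Qed.

Lemma convex_efunZ (t : R) g : 0 < t -> proper_fun g -> convex_efun g ->
  convex_efun (fun y => t%:E * g y)%E.
Proof.
move=> t0 [_ gNy] gc x y l l01.
have /andP[l0 l1] := l01.
have l1' : 0 < 1 - l by rewrite subr_gt0.
apply: (@le_trans _ _ (t%:E * (l%:E * g x + (1 - l)%:E * g y))%E).
  by rewrite lee_pmul2l ?lte_fin// gc.
have := gNy x; have := gNy y.
case: (g x) => [a||]//=; case: (g y) => [b||]//= _ _.
- by rewrite -!(EFinM, EFinD) lee_fin; nra.
- by rewrite !(gt0_muley, addey, addye) ?lte_fin// leey.
- by rewrite !(gt0_muley, addey, addye) ?lte_fin// leey.
- by rewrite !(gt0_muley, addey, addye) ?lte_fin// leey.
Qed.

Lemma prox_fin_num g z p : proper_fun g -> is_prox g z p -> g p \is a fin_num.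
Proof.
move=> [[x gx] gNy] /(_ x).
have := gNy p; case: (g p) => [a||]//= _.
by case: (g x) gx => [b||]//= _; rewrite addye.
Qed.

(** That is, [z - p] is a subgradient of [g] at [p]. Compare the prox objective at [p] with its
    value on the segment towards [q]. *)
Lemma prox_variational g z p q a b : convex_efun g -> is_prox g z p ->
  g p = a%:E -> g q = b%:E -> a + dotp (z - p) (q - p) <= b.
Proof.
move=> gc gp ga gb; rewrite -subr_ge0.
apply: (@linear_ge0_of_quadratic _ _ (enorm (q - p) ^+ 2 / 2)) => l l01.
have := gc q p l l01; have := gp (l *: q + (1 - l) *: p).
rewrite ga gb -!(EFinM, EFinD).
case: (g _) => [c||]//=.
rewrite -EFinD !lee_fin.
have -> : l *: q + (1 - l) *: p - z = (p - z) + l *: (q - p).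
  by apply/rowP => i; rewrite !mxE; ring.
rewrite -(opprB p z) !enorm_sqr !dotpNl; move: (p - z) (q - p) => d e.
rewrite !dotpE (dotpC e d); lra.
Qed.

Lemma prox_nonexpansive g z w p q : proper_fun g -> convex_efun g ->
  is_prox g z p -> is_prox g w q -> enorm (p - q) <= enorm (z - w).
Proof.
move=> gpr gc gp gq.
have /EFin_fin_numP[a ga] := prox_fin_num gpr gp.
have /EFin_fin_numP[b gb] := prox_fin_num gpr gq.
have := prox_variational gc gp ga gb; have := prox_variational gc gq gb ga.
rewrite -(opprB p q) dotpNr => H1 H2.
(* Firm nonexpansiveness, from the sum of the two subgradient inequalities; Cauchy-Schwarz then
   finishes. *)
have H : enorm (p - q) ^+ 2 <= dotp (z - w) (p - q).
  have -> : z - w = (p - q) + ((z - p) - (w - q)).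
    by apply/rowP => i; rewrite !mxE; ring.
  by rewrite enorm_sqr [leRHS]dotpDl lerDl dotpDl dotpNl; lra.
have := le_trans H (dotp_le_enorm _ _).
have [->|pq0] := eqVneq (enorm (p - q)) 0; first by rewrite enorm_ge0.
by rewrite expr2 ler_pM2r// lt0r pq0 enorm_ge0.
Qed.

Lemma prox_gradient_nonexpansive f gf L g (t : R) prox :
  0 < L -> convex_fun f -> has_gradient f gf -> lipschitz_with gf L ->
  proper_fun g -> convex_efun g -> 0 < t <= 1 / L ->
  (forall z, is_prox (fun y => t%:E * g y)%E z (prox z)) ->
  forall x y, enorm (prox (x - t *: gf x) - prox (y - t *: gf y)) <= enorm (x - y).
Proof.
move=> L0 fc fgf gfL gp gc tL proxP x y; have /andP[t0 _] := tL.
apply: le_trans (gradient_step_nonexpansive x y L0 fc fgf gfL tL).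
exact: prox_nonexpansive (proper_funZ t0 gp) (convex_efunZ t0 gp gc) _ _.
Qed.

End Prox.

(** * Limit superior and recursive inequalities for real sequences *)

Section RealSequences.
Variable R : realType.
Implicit Types (a v alpha : nat -> R) (c e : R).

Lemma limn_esup_near_lt v c : (limn_esup (fun k => (v k)%:E) < c%:E)%E ->
  \forall k \near \oo, v k < c.
Proof.
rewrite /limn_esup limf_esupE => /ereal_inf_lt[_ [A [N _ NA] <-] supA].
exists N => // k Nk.
rewrite -lte_fin; apply: le_lt_trans supA; apply: ereal_sup_ubound.
by exists k => //; exact: NA.
Qed.

(* The factor 1 + (partial sum) beats the decay: (1 - g)(1 + s + g) <= 1 + s. *)
Lemma recursive_decay a alpha (b0 : R) N :
  (forall k, 0 <= alpha k) -> 0 <= b0 -> a N <= b0 -> (forall k, 0 <= a k) ->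
  (forall k, (N <= k)%N -> a k.+1 <= (1 - alpha k) * a k) ->
  forall m, a (N + m)%N * (1 + \sum_(N <= k < N + m) alpha k) <= b0.
Proof.
move=> al0 b00 aN a0 aS; elim=> [|m IH].
  by rewrite addn0 big_geq// addr0 mulr1.
have s0 : 0 <= \sum_(N <= k < N + m) alpha k by apply: sumr_ge0.
rewrite addnS big_nat_recr ?leq_addr//=.
have := aS (N + m)%N (leq_addr _ _); have := a0 (N + m)%N; have := al0 (N + m)%N.
move: s0 IH; move: (\sum_(_ <= _ < _) _) (alpha _) (a (N + m)%N) (a _.+1).
move=> s g x y s0 IH g0 x0 yx.
apply: le_trans IH; apply: (@le_trans _ _ ((1 - g) * x * (1 + (s + g)))).
  by rewrite ler_wpM2r//; lra.
have : 0 <= x * (g * (s + g)) by rewrite !mulr_ge0// addr_ge0.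
lra.
Qed.

(* Xu's lemma, the perturbation being o(alpha k). *)
Lemma xu_lemma a alpha c :
  0 < c <= 1 -> (forall k, 0 < alpha k < 1) ->
  (fun N => \sum_(0 <= k < N) alpha k) @ \oo --> +oo ->
  (forall e, 0 < e -> \forall k \near \oo,
     a k.+1 <= (1 - c * alpha k) * a k + alpha k * e) ->
  forall e, 0 < e -> \forall k \near \oo, a k < e.
Proof.
move=> /andP[c0 c1] al01 sumoo aS e e0.
have [N _ HN] := aS (c * (e / 2)) (mulr_gt0 c0 (divr_gt0 e0 (ltr0Sn _ 1))).
(* With perturbation [c * (e / 2) * alpha k], the level [e / 2] is a fixed point of the recursion,
   so the excess over it obeys the homogeneous one. *)
pose b k := Num.max 0 (a k - e / 2).
have b0 k : 0 <= b k by rewrite le_max lexx.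
have gal k : 0 <= 1 - c * alpha k.
  by have /andP[? ?] := al01 k; nra.
have bS k : (N <= k)%N -> b k.+1 <= (1 - c * alpha k) * b k.
  move=> Nk; rewrite ge_max mulr_ge0//=.
  have ab : a k - e / 2 <= b k by rewrite le_max lexx orbT.
  have := ler_wpM2l (gal k) ab; have := HN k Nk; lra.
have dec := recursive_decay (fun k => mulr_ge0 (ltW c0) (ltW (andP (al01 k)).1))
  (b0 N) (lexx _) b0 bS.
(* Beyond [N'] the sum of [c * alpha] from [N] is at least [b N / (e / 2)], so [b k >= e / 2] would
   contradict [dec]. *)
have /cvgryPge/(_ (\sum_(0 <= k < N) alpha k + (b N / (e / 2)) / c)) [N' _ HN'] := sumoo.
exists (maxn N N') => // k /=; rewrite geq_max => /andP[Nk N'k].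
have := dec (k - N)%N; rewrite subnKC// -mulr_sumr => bk.
have := HN' k N'k; rewrite [leRHS](@big_cat_nat _ _ _ N)//= lerD2l ler_pdivrMr// ler_pdivrMr; last by lra.
move: (\sum_(_ <= _ < _) _) bk => s bk bNs.
have : b k < e / 2.
  rewrite ltNge; apply/negP => eb.
  have bk0 : 0 < b k by lra.
  have := b0 N; nra.
by rewrite gt_max => /andP[_]; lra.
Qed.

Lemma near_shiftS (P : nat -> Prop) :
  (\forall k \near \oo, P k.+1) -> \forall k \near \oo, P k.
Proof.
by move=> [N _ HN]; exists N.+1 => // -[//|k] /= Nk; exact: HN.
Qed.

Lemma near_shift (P : nat -> Prop) :
  (\forall k \near \oo, P k) -> \forall k \near \oo, P k.+1.
Proof. by move=> [N _ HN]; exists N => // k /= Nk; apply: HN => /=; exact: leqW. Qed.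

End RealSequences.

(** * The variational inequality for [I - T] over the fixed points of [W] *)

Definition nonexpansive (R : realType) (n : nat) (F : 'rV[R]_n -> 'rV[R]_n) :=
  forall x y, enorm (F x - F y) <= enorm (x - y).

Section VariationalInequality.
Variables (R : realType) (n : nat).
Implicit Types (x y z p w : 'rV[R]_n).
Variables T W : 'rV[R]_n -> 'rV[R]_n.
Hypotheses (Tne : nonexpansive T) (Wne : nonexpansive W).

Definition vi_solutions : set 'rV[R]_n := [set z | fixpts W z /\
  forall y, fixpts W y -> 0 <= dotp (z - T z) (y - z)].

Lemma residual_monotone x y :
  dotp (y - T y) (x - y) <= dotp (x - T x) (x - y).
Proof.
have := dotp_le_enorm (T x - T y) (x - y).
have := ler_wpM2r (enorm_ge0 (x - y)) (Tne x y).
rewrite -expr2 enorm_sqr !dotpE; lra.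
Qed.

Lemma residual_lipschitz x y :
  enorm ((x - T x) - (y - T y)) <= 2 * enorm (x - y).
Proof.
have -> : (x - T x) - (y - T y) = (x - y) - (T x - T y).
  by apply/rowP => i; rewrite !mxE; ring.
by apply: le_trans (enormB _ _) _; have := Tne x y; lra.
Qed.

(** With [D = enorm (x - y)], [W z] lies within [(1 - l) D] of [x] and [l D] of [y]. Inserted in
    [enorm_convex_comb], these bounds cancel exactly and force [W z = z]. *)
Lemma fixpts_convex x y (l : R) : 0 <= l <= 1 ->
  fixpts W x -> fixpts W y -> fixpts W (l *: x + (1 - l) *: y).
Proof.
move=> /andP[l0 l1] Wx Wy; set z := l *: x + (1 - l) *: y.
have zx : enorm (W z - x) <= (1 - l) * enorm (x - y).
  rewrite -{1}Wx; apply: le_trans (Wne _ _) _.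
  have -> : z - x = (1 - l) *: (y - x).
    by apply/rowP => i; rewrite /z !mxE; ring.
  by rewrite enormZ ger0_norm ?subr_ge0// enormBC.
have zy : enorm (W z - y) <= l * enorm (x - y).
  rewrite -{1}Wy; apply: le_trans (Wne _ _) _.
  have -> : z - y = l *: (x - y).
    by apply/rowP => i; rewrite /z !mxE; ring.
  by rewrite enormZ ger0_norm.
have zE : W z - z = l *: (W z - x) + (1 - l) *: (W z - y).
  by apply/rowP => i; rewrite /z !mxE; ring.
apply/subr0_eq/enorm_eq0/eqP; rewrite -sqrf_eq0 eq_le sqr_ge0 andbT.
rewrite zE enorm_convex_comb.
have -> : W z - x - (W z - y) = y - x by apply/rowP => i; rewrite !mxE; ring.
rewrite (enormBC y); set D := enorm (x - y) in zx zy *.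
have D0 : 0 <= D := enorm_ge0 _.
have zx2 : enorm (W z - x) ^+ 2 <= ((1 - l) * D) ^+ 2.
  by rewrite lerXn2r ?nnegrE ?enorm_ge0// mulr_ge0// subr_ge0.
have zy2 : enorm (W z - y) ^+ 2 <= (l * D) ^+ 2.
  by rewrite lerXn2r ?nnegrE ?enorm_ge0// mulr_ge0.
have := ler_wpM2l l0 zx2; have := ler_wpM2l (_ : 0 <= 1 - l) zy2.
rewrite subr_ge0 => /(_ l1); lra.
Qed.

(** Test the hypothesis at [l y + (1 - l) z]; replacing the residual there by the one at [z] costs
    only [O(l)] by Lipschitz continuity. The Minty form is affine in [z], which gives convexity of
    the solution set. *)
Lemma minty z : fixpts W z ->
  (forall y, fixpts W y -> 0 <= dotp (y - T y) (y - z)) -> vi_solutions z.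
Proof.
move=> Wz H; split=> // y Wy.
apply: (@linear_ge0_of_quadratic _ _ (2 * enorm (y - z) ^+ 2)) => l /andP[l0 l1].
pose w := l *: y + (1 - l) *: z.
have wz : w - z = l *: (y - z) by apply/rowP => i; rewrite /w !mxE; ring.
have l01 : 0 <= l <= 1 by rewrite (ltW l0) (ltW l1).
have := H w (fixpts_convex l01 Wy Wz).
have := residual_lipschitz w z.
rewrite wz dotpZr enormZ gtr0_norm// pmulr_rge0// => rl.
rewrite -{1}(subrK (z - T z) (w - T w)).
move: rl; set d := w - T w - _ => rl.
have := le_trans (dotp_le_enorm d (y - z)) (ler_wpM2r (enorm_ge0 _) rl).
rewrite (dotpDl d) => dl dge; rewrite expr2 -mulrA -mulrDr pmulr_rge0//; lra.
Qed.

Lemma vi_solutions_convex x y (l : R) : 0 <= l <= 1 ->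
  vi_solutions x -> vi_solutions y -> vi_solutions (l *: x + (1 - l) *: y).
Proof.
move=> l01 [Wx Hx] [Wy Hy]; apply: minty; first exact: fixpts_convex.
move=> w Ww.
have := le_trans (Hx w Ww) (residual_monotone w x).
have := le_trans (Hy w Ww) (residual_monotone w y).
have -> : w - (l *: x + (1 - l) *: y) = l *: (w - x) + (1 - l) *: (w - y).
  by apply/rowP => i; rewrite !mxE; ring.
have /andP[l0 l1] := l01.
by move=> ? ?; rewrite dotpDr !dotpZr addr_ge0// mulr_ge0// subr_ge0.
Qed.

(** The nearby points need only be approximate solutions, so the lemma covers both limits of points
    of Omega and cluster points of the iteration. *)
Lemma vi_solutions_closed p : fixpts W !=set0 ->
  (forall e z, 0 < e -> fixpts W z -> exists y,
    [/\ enorm (y - p) < e, enorm (y - W y) < e & - e < dotp (y - T y) (z - y)]) ->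
  vi_solutions p.
Proof.
move=> [z0 Wz0] H; split=> [|z Wz].
  apply/esym/subr0_eq/enorm_eq0/eqP; rewrite eq_le enorm_ge0 andbT.
  apply/ler_addgt0Pl => e e0; rewrite addr0.
  have [y [yp yW _]] := H _ _ (divr_gt0 e0 (ltr0Sn R 2)) Wz0.
  have -> : p - W p = (y - W y) - ((y - p) - (W y - W p)).
    by apply/rowP => i; rewrite !mxE; ring.
  apply: le_trans (enormB _ _) _.
  have := enormB (y - p) (W y - W p); have := Wne y p; lra.
(* The constant collects the errors of moving from [y] to [p], in units of [e]: 1 from the
   approximate inequality, 2 from the product of the two small differences, and one term for each of
   the other two products. *)
apply: (@linear_ge0_of_quadratic _ _ (3 + enorm (p - T p) + 2 * enorm (z - p))).
move=> e /andP[e0 e1]; rewrite expr2 -mulrA -mulrDr pmulr_rge0//.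
have [y [yp _ yT]] := H _ _ e0 Wz.
have rE : dotp (p - T p) (z - p) = dotp (y - T y) (z - y) + dotp (p - T p) (y - p)
    + dotp ((y - T y) - (p - T p)) (y - p) - dotp ((y - T y) - (p - T p)) (z - p).
  move: (y - T y) (p - T p) => r q.
  have -> : z - y = (z - p) - (y - p) by apply/rowP => i; rewrite !mxE; ring.
  by move: (z - p) (y - p) => v w; rewrite !dotpE; ring.
have := residual_lipschitz y p; rewrite {}rE.
move: (y - T y - (p - T p)) => r rle.
have := dotp_ge_Nenorm (p - T p) (y - p).
have := dotp_ge_Nenorm r (y - p).
have := dotp_le_enorm r (z - p).
have := enorm_ge0 (p - T p); have := enorm_ge0 (z - p).
have := enorm_ge0 (y - p); have := enorm_ge0 r.
move: rle yp yT; move: (enorm (y - p)) (enorm r) (enorm (p - T p)) (enorm (z - p)).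
move=> d nr np nz rle yp yT r0 d0 z0' p0 H1 H2 H3.
have k1 : nr * nz <= 2 * e * nz by rewrite ler_wpM2r//; lra.
have k2 : nr * d <= 2 * e * 1 by apply: ler_pM => //; lra.
have k3 : np * d <= np * e by rewrite ler_wpM2l// ltW.
lra.
Qed.

End VariationalInequality.

(** * Existence and first-order optimality of minimisers of a strongly convex function *)

Section Minimizer.
Variables (R : realType) (n : nat).
Implicit Types (y z p : 'rV[R]_n).
Variables (f : 'rV[R]_n -> R) (gf : 'rV[R]_n -> 'rV[R]_n) (mu L : R).
Hypotheses (mu0 : 0 < mu) (fmu : strongly_convex_fun f mu).
Hypotheses (fgf : has_gradient f gf) (gfL : lipschitz_with gf L).

Lemma strongly_convex_sublevel_bounded c : exists M, forall y, f y <= c -> enorm y <= M.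
Proof.
pose G := enorm (gf 0).
pose K := `|c - f 0|.
(* The lower bound at 0 gives [mu / 2 * N ^+ 2 <= K + G * N] for [N = enorm y]. A larger [N] has
   [N >= 1] and [mu * N > 2 * (G + K + 1)], a contradiction. *)
exists (2 * (G + K + 1) / mu + 1) => y fyc.
have := strongly_convex_gradient 0 y fmu fgf gfL.
rewrite subr0 => H; have := dotp_ge_Nenorm (gf 0) y; rewrite -/G => H2.
have cK : c - f 0 <= K := ler_norm _.
have G0 : 0 <= G := enorm_ge0 _.
have K0 : 0 <= K := normr_ge0 _.
set N := enorm y in H H2 *; have N0 : 0 <= N := enorm_ge0 _.
rewrite leNgt; apply/negP => NM.
have N1 : 1 <= N.
  apply/ltW/le_lt_trans/NM.
  by rewrite lerDr divr_ge0 ?mulr_ge0// ?ltW//; lra.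
have : 2 * (G + K + 1) < mu * N.
  rewrite -ltr_pdivrMl// mulrC; lra.
nra.
Qed.

(* Convexity replaces continuity of f: f is minorised by its tangents. *)
Lemma strongly_convex_argmin (A : set 'rV[R]_n) : A !=set0 ->
  (forall p, (forall e, 0 < e -> exists y, A y /\ enorm (y - p) < e) -> A p) ->
  exists2 p, A p & forall z, A z -> f p <= f z.
Proof.
move=> [z0 Az0] Acl.
have [M HM] := strongly_convex_sublevel_bounded (f z0 + 1).
have tan x y : f x + dotp (gf x) (y - x) <= f y.
  apply: le_trans (strongly_convex_gradient x y fmu fgf gfL).
  by rewrite lerDl mulr_ge0 ?sqr_ge0// divr_ge0// ltW.
pose E := [set f z | z in A].
have E0 : E !=set0 by exists (f z0), z0.
have [B HB] : exists B, lbound E B.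
  (* Either [f z] is at least [f z0], or [z] lies in the bounded sublevel set, where the tangent at
     0 is bounded below. *)
  exists (Num.min (f z0) (f 0 - enorm (gf 0) * M)) => _ [z Az <-].
  have [zz0|zz0] := leP (f z0) (f z); first by rewrite ge_min zz0.
  rewrite ge_min; apply/orP; right.
  have zM : enorm z <= M by apply: HM; lra.
  apply: le_trans (tan 0 z); rewrite subr0 lerD2l lerNl.
  rewrite -lerNl; apply: le_trans (dotp_ge_Nenorm _ _).
  by rewrite lerN2 ler_wpM2l ?enorm_ge0.
have Einf : has_inf E by split=> //; exists B.
have /choice[y Hy] : forall k : nat, exists z,
    A z /\ f z < inf E + k.+1%:R^-1.
  move=> k; have k0 : 0 < k.+1%:R^-1 :> R by rewrite invr_gt0.
  have [_ [z Az <-] fz] := inf_adherent k0 Einf.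
  by exists z.
have fz0 : inf E <= f z0 by apply: ge_inf; [exists B|exists z0].
have yM k : enorm (y k) <= M.
  apply: HM; apply/ltW/(lt_le_trans (Hy k).2); apply: lerD => //.
  by rewrite invf_le1// ler1n.
have [|p Hp] := @bounded_cluster_seq _ _ y M (fun=> True) yM.
  by move=> N; exists N.
exists p.
  apply: Acl => e e0; have [k [_ _ yk]] := Hp e 0%N e0.
  by exists (y k); split=> //; exact: (Hy k).1.
move=> z Az; apply: (@le_trans _ _ (inf E)); last first.
  by apply: ge_inf; [exists B|exists z].
apply/ler_addgt0Pl => /= e e0.
(* Within [e'] of [p] the tangent at [p] drops by at most [e / 2]; the other half pays for [f (y k)]
   exceeding the infimum. *)
pose e' : R := e / 2 / (enorm (gf p) + 1).
have g1 : 0 < enorm (gf p) + 1 by rewrite ltr_wpDl ?enorm_ge0.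
have e'0 : 0 < e' by rewrite !divr_gt0.
have [N _ HN] := near_infty_natSinv_lt (PosNum (divr_gt0 e0 (ltr0Sn R 1))).
have [k [Nk _ yk]] := Hp e' N e'0.
have := HN k Nk => /= kN.
have := tan p (y k); have := (Hy k).2.
have := dotp_ge_Nenorm (gf p) (y k - p).
have : enorm (gf p) * enorm (y k - p) <= (enorm (gf p) + 1) * e'.
  by apply: ler_pM; rewrite ?enorm_ge0 ?ltW//; rewrite ltrDl.
rewrite [_ * e']mulrC divfK ?gt_eqF//.
move: kN; move: (k.+1%:R^-1) => i; lra.
Qed.

Lemma argmin_gradient_vi (A : set 'rV[R]_n) p :
  (forall x y (l : R), 0 <= l <= 1 -> A x -> A y -> A (l *: x + (1 - l) *: y)) ->
  A p -> (forall z, A z -> f p <= f z) ->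
  forall z, A z -> 0 <= dotp (gf p) (z - p).
Proof.
move=> Aconv Ap pmin z Az.
apply: (@linear_ge0_of_quadratic _ _ (L / 2 * dotp (z - p) (z - p))) => l /andP[l0 l1].
have l01 : 0 <= l <= 1 by rewrite (ltW l0) (ltW l1).
have := pmin _ (Aconv z p l l01 Az Ap).
have -> : l *: z + (1 - l) *: p = p + l *: (z - p).
  by apply/rowP => i; rewrite !mxE; ring.
have := descent_lemma p (l *: (z - p)) fgf gfL; rewrite !dotpE; lra.
Qed.

End Minimizer.

(** * Asymptotic regularity of the trilevel iteration and its cluster points *)

Section Iteration.
Variables (R : realType) (n : nat).
Variables (S T W : 'rV[R]_n -> 'rV[R]_n) (c K : R).
Variables (alpha beta : nat -> R) (x : nat -> 'rV[R]_n).
Hypotheses (c01 : 0 < c <= 1) (Sc : lipschitz_with S (1 - c)).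
Hypotheses (Tne : nonexpansive T) (Wne : nonexpansive W).
Hypotheses (al01 : forall k, 0 < alpha k < 1) (be01 : forall k, 0 < beta k < 1).
Hypothesis beta_over_alpha : (fun k => beta k / alpha k) @ \oo --> +oo.
Hypothesis sum_alpha : (fun N => \sum_(0 <= k < N) alpha k) @ \oo --> +oo.
Hypothesis K0 : 0 < K.
Hypothesis inv_beta_variation : \forall k \near \oo,
  `|(beta k.+1)^-1 - (beta k)^-1| <= K * alpha k.+1.
Hypothesis variation : forall e, 0 < e -> \forall k \near \oo,
  `|beta k.+1 - beta k| + `|alpha k.+1 - alpha k| <= e * (alpha k.+1 * beta k.+1).
Hypothesis beta_sqr : forall e, 0 < e -> \forall k \near \oo,
  beta k ^+ 2 <= e * alpha k.
Hypothesis iterE : forall k, x k.+1 = alpha k *: S (x k) +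
  ((1 - alpha k) * beta k) *: T (x k) + ((1 - alpha k) * (1 - beta k)) *: W (x k).
Variable B : R.
Hypothesis B0 : 0 < B.
Hypothesis xB : forall k, enorm (x k) <= B.
Hypothesis SB : forall k, enorm (S (x k)) <= B.
Hypothesis TB : forall k, enorm (T (x k)) <= B.
Hypothesis WB : forall k, enorm (W (x k)) <= B.

Let D k := enorm (x k.+1 - x k).

(** Split the increment into the maps' variation under the new weights, contracting by [alpha (1 -
    c) + (1 - alpha) = 1 - c alpha], and the weights' variation times differences bounded by
    [2 * B]. *)
Let D_rec k : D k.+1 <= (1 - c * alpha k.+1) * D k +
  2 * B * (`|beta k.+1 - beta k| + `|alpha k.+1 - alpha k|).
Proof.
have [/andP[a0 a1] /andP[b0 b1]] := (al01 k.+1, be01 k.+1).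
have /andP[b0' b1'] := be01 k.
have -> : D k.+1 = enorm (alpha k.+1 *: (S (x k.+1) - S (x k)) +
   (alpha k.+1 - alpha k) *: (S (x k) - (beta k *: T (x k) + (1 - beta k) *: W (x k))) +
   (1 - alpha k.+1) *: (beta k.+1 *: (T (x k.+1) - T (x k)) +
      (1 - beta k.+1) *: (W (x k.+1) - W (x k)) +
      (beta k.+1 - beta k) *: (T (x k) - W (x k)))).
  rewrite /D (iterE k.+1); congr enorm.
  move: (S (x k.+1)) (T (x k.+1)) (W (x k.+1)) => s t w.
  by rewrite (iterE k); apply/rowP => i; rewrite !mxE; ring.
have p1 : enorm (alpha k.+1 *: (S (x k.+1) - S (x k))) <= alpha k.+1 * ((1 - c) * D k).
  by rewrite enormZ gtr0_norm// ler_wpM2l ?(ltW a0)//; exact: Sc.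
have p2 : enorm (S (x k) - (beta k *: T (x k) + (1 - beta k) *: W (x k))) <= 2 * B.
  apply: le_trans (enormB _ _) _.
  have := enormD (beta k *: T (x k)) ((1 - beta k) *: W (x k)).
  rewrite !enormZ gtr0_norm// gtr0_norm ?subr_gt0//.
  have := ler_wpM2l (ltW b0') (TB k).
  have := ler_wpM2l (_ : 0 <= 1 - beta k) (WB k); rewrite subr_ge0 => /(_ (ltW b1')).
  have := SB k; lra.
have p3 : enorm (T (x k) - W (x k)) <= 2 * B.
  by apply: le_trans (enormB _ _) _; have := TB k; have := WB k; lra.
have p4 := Tne (x k.+1) (x k); have p5 := Wne (x k.+1) (x k).
have q1 := enormD (beta k.+1 *: (T (x k.+1) - T (x k)) +
      (1 - beta k.+1) *: (W (x k.+1) - W (x k)))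
      ((beta k.+1 - beta k) *: (T (x k) - W (x k))).
have q2 := enormD (beta k.+1 *: (T (x k.+1) - T (x k)))
      ((1 - beta k.+1) *: (W (x k.+1) - W (x k))).
apply: le_trans (enormD _ _) _.
apply: le_trans (lerD (enormD _ _) (lexx _)) _.
rewrite (enormZ (1 - alpha k.+1)) (enormZ (alpha k.+1 - alpha k)).
rewrite !enormZ in q1 q2.
rewrite (gtr0_norm b0) in q2.
rewrite gtr0_norm ?subr_gt0// in q2.
rewrite (@gtr0_norm _ (1 - alpha k.+1)) ?subr_gt0//.
rewrite -/(D k) in p4 p5.
have nb : 0 <= 1 - beta k.+1 by rewrite subr_ge0 ltW.
have na : 0 <= 1 - alpha k.+1 by rewrite subr_ge0 ltW.
have r1 := ler_wpM2l (ltW b0) p4; have r2 := ler_wpM2l nb p5.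
have r3 := ler_wpM2l (normr_ge0 (beta k.+1 - beta k)) p3.
have r4 := ler_wpM2l (normr_ge0 (alpha k.+1 - alpha k)) p2.
have q3 : enorm (beta k.+1 *: (T (x k.+1) - T (x k)) +
      (1 - beta k.+1) *: (W (x k.+1) - W (x k)) +
      (beta k.+1 - beta k) *: (T (x k) - W (x k))) <=
   D k + `|beta k.+1 - beta k| * (2 * B) by lra.
have r5 := ler_wpM2l na q3.
have r6 : 0 <= alpha k.+1 * (`|beta k.+1 - beta k| * (2 * B)).
  by rewrite !mulr_ge0 ?(ltW a0) ?(ltW B0).
lra.
Qed.

Let D_small e : 0 < e -> \forall k \near \oo, D k < e.
Proof.
move=> e0.
(* [xu_lemma] pairs index [k] with [alpha k], while [D_rec] carries [alpha k.+1]; hence the shift by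
   one. *)
suff : \forall k \near \oo, enorm (x k - x k.-1) < e by move/near_shift.
move: e e0; apply: (xu_lemma c01 al01 sum_alpha) => e e0.
have e'0 : 0 < e / (2 * B) by rewrite divr_gt0// mulr_gt0.
have V := variation e'0.
apply: near_shiftS; near=> k => /=.
apply: le_trans (D_rec k) _; rewrite lerD2l.
have : `|beta k.+1 - beta k| + `|alpha k.+1 - alpha k| <=
   e / (2 * B) * (alpha k.+1 * beta k.+1) by near: k; exact: V.
have B2 : 0 < 2 * B by rewrite mulr_gt0.
move=> /(ler_wpM2l (ltW B2)) H; apply: le_trans H _.
have -> : 2 * B * (e / (2 * B) * (alpha k.+1 * beta k.+1)) = alpha k.+1 * e * beta k.+1.
  by field; rewrite gt_eqF.
have /andP[a0 _] := al01 k.+1; have /andP[_ b1] := be01 k.+1.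
by rewrite ger_pMr ?mulr_gt0// ltW.
Unshelve. all: by end_near. Qed.

(** Apply Xu's lemma to [D k / beta k]. Passing from [(beta k)^-1] to [(beta k.+1)^-1] costs at most
    [K * alpha k.+1 * D k], which is [o(alpha k.+1)] by [D_small]. *)
Let D_beta e : 0 < e -> \forall k \near \oo, D k < e * beta k.
Proof.
move=> e0.
suff : \forall k \near \oo, enorm (x k - x k.-1) / beta k.-1 < e.
  move/near_shift => /=; apply: filterS => k.
  by rewrite ltr_pdivrMr//; have /andP[] := be01 k.
move: e e0; apply: (xu_lemma c01 al01 sum_alpha) => e e0.
have B2 : 0 < 2 * B by rewrite mulr_gt0.
have e'0 : 0 < e / 2 / (2 * B) by rewrite !divr_gt0.
have e''0 : 0 < e / 2 / K by rewrite !divr_gt0.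
have V := variation e'0; have Ds := D_small e''0.
apply: near_shiftS; near=> k => /=; rewrite -!/(D _).
have v1 : `|beta k.+1 - beta k| + `|alpha k.+1 - alpha k| <=
   e / 2 / (2 * B) * (alpha k.+1 * beta k.+1) by near: k; exact: V.
have v2 : D k < e / 2 / K by near: k; exact: Ds.
have v3 : `|(beta k.+1)^-1 - (beta k)^-1| <= K * alpha k.+1.
  by near: k; exact: inv_beta_variation.
have /andP[a0 a1] := al01 k.+1; have /andP[b0 _] := be01 k.+1.
have D0 : 0 <= D k := enorm_ge0 _.
have ca : 0 <= 1 - c * alpha k.+1 by move: c01 => /andP[? ?]; nra.
rewrite ler_pdivrMr//; apply: le_trans (D_rec k) _.
have v1' : 2 * B * (`|beta k.+1 - beta k| + `|alpha k.+1 - alpha k|) <=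
    e / 2 * (alpha k.+1 * beta k.+1).
  move: v1 => /(ler_wpM2l (ltW B2)) H; apply: le_trans H _.
  by rewrite le_eqVlt; apply/orP; left; apply/eqP; field; rewrite gt_eqF.
have v2' : K * D k <= e / 2 by rewrite mulrC -ler_pdivlMr// ltW.
have v3' : (beta k.+1)^-1 <= (beta k)^-1 + K * alpha k.+1.
  by move: v3; rewrite ler_norml => /andP[_]; lra.
have bD : D k <= D k * ((beta k)^-1 + K * alpha k.+1) * beta k.+1.
  rewrite -mulrA ler_peMr//.
  by have := ler_wpM2r (ltW b0) v3'; rewrite mulVf ?gt_eqF.
have h1 := ler_wpM2l ca bD.
have h2 : K * D k * (alpha k.+1 * beta k.+1) <= e / 2 * (alpha k.+1 * beta k.+1).
  by rewrite ler_wpM2r// mulr_ge0 ?ltW.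
have h3 : 0 <= (c * alpha k.+1) * (K * D k * (alpha k.+1 * beta k.+1)).
  have /andP[c0 _] := c01.
  by rewrite !mulr_ge0// ltW.
lra.
Unshelve. all: by end_near. Qed.

Let alpha_beta e : 0 < e -> \forall k \near \oo, alpha k <= e * beta k.
Proof.
move=> e0; have /cvgryPge/(_ e^-1) := beta_over_alpha; apply: filterS => k.
have /andP[a0 _] := al01 k.
by rewrite ler_pdivlMr// ler_pdivrMl.
Qed.

Let beta_small e : 0 < e -> \forall k \near \oo, beta k < e.
Proof.
move=> e0; apply: filterS (beta_sqr (exprn_gt0 2 e0)) => k bk.
have /andP[b0 _] := be01 k; have /andP[_ a1] := al01 k.
rewrite -(@ltr_pXn2r _ 2) ?nnegrE ?(ltW b0) ?(ltW e0)//.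
by apply: le_lt_trans bk _; rewrite gtr_pMr ?exprn_gt0.
Qed.

(** Solve the iteration for [x k - W (x k)]: the increment contributes [beta k], and the [S] and [T]
    terms [2 * B * beta k] each, since eventually [alpha k <= beta k]. *)
Let W_residual : \forall k \near \oo, enorm (x k - W (x k)) <= (1 + 4 * B) * beta k.
Proof.
have Db := D_beta ltr01; have ab := alpha_beta ltr01.
near=> k.
have h1 : D k < 1 * beta k by near: k; exact: Db.
have h2 : alpha k <= 1 * beta k by near: k; exact: ab.
have /andP[a0 a1] := al01 k; have /andP[b0 _] := be01 k.
have -> : x k - W (x k) = - (x k.+1 - x k) + (alpha k *: (S (x k) - W (x k)) +
   ((1 - alpha k) * beta k) *: (T (x k) - W (x k))).
  by rewrite (iterE k); apply/rowP => i; rewrite !mxE; ring.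
apply: le_trans (enormD _ _) _; rewrite enormN -/(D k).
have := enormD (alpha k *: (S (x k) - W (x k))) (((1 - alpha k) * beta k) *: (T (x k) - W (x k))).
rewrite !enormZ gtr0_norm// gtr0_norm ?mulr_gt0 ?subr_gt0// => h3.
have s1 : enorm (S (x k) - W (x k)) <= 2 * B.
  by apply: le_trans (enormB _ _) _; have := SB k; have := WB k; lra.
have s2 : enorm (T (x k) - W (x k)) <= 2 * B.
  by apply: le_trans (enormB _ _) _; have := TB k; have := WB k; lra.
have s3 : alpha k * enorm (S (x k) - W (x k)) <= beta k * (2 * B).
  by apply: ler_pM; rewrite ?enorm_ge0 ?(ltW a0)//; lra.
have s4 : (1 - alpha k) * beta k * enorm (T (x k) - W (x k)) <= beta k * (2 * B).
  apply: ler_pM; rewrite ?enorm_ge0 ?mulr_ge0 ?subr_ge0 ?(ltW a1) ?(ltW b0)//.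
  by rewrite ger_pMl//; lra.
lra.
Unshelve. all: by end_near. Qed.

(** Pair the increment with [x k - z]. The [W] term is nonnegative by monotonicity of [I - W]; the
    increment and the [S] term are [o(beta k)]. Dividing by [beta k] isolates the [T] term. *)
Let T_residual e z : 0 < e -> fixpts W z ->
  \forall k \near \oo, - e < dotp (x k - T (x k)) (z - x k).
Proof.
move=> e0 Wz.
pose Z := B + enorm z.
have Z0 : 0 < Z by rewrite ltr_wpDr ?enorm_ge0.
pose e1 := e / (2 * (1 + 2 * B) * Z + 1) / 2.
have B1 : 0 < 1 + 2 * B by rewrite addr_gt0// mulr_gt0.
have den : 0 < 2 * (1 + 2 * B) * Z + 1 by rewrite addr_gt0// !mulr_gt0.
have e10 : 0 < e1 by rewrite !divr_gt0.
have e1E : (2 * (1 + 2 * B) * Z + 1) * (2 * e1) = e.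
  by rewrite /e1 (mulrC 2 (_ / _)) divfK// mulrC divfK// gt_eqF.
(* Eventually [alpha k <= beta k / 2 < 1 / 2], so the factor [1 - alpha k] of the [T] term is at
   least one half. *)
have half0 : 0 < 2^-1 :> R by rewrite invr_gt0.
have Db := D_beta e10; have ab := alpha_beta e10; have ab2 := alpha_beta half0.
near=> k.
have h1 : D k < e1 * beta k by near: k; exact: Db.
have h2 : alpha k <= e1 * beta k by near: k; exact: ab.
have h3 : alpha k <= 2^-1 * beta k by near: k; exact: ab2.
have /andP[a0 a1] := al01 k; have /andP[b0 b1] := be01 k.
have xz : enorm (x k - z) <= Z by apply: le_trans (enormB _ _) _; rewrite lerD2r.
have s1 : enorm (x k - S (x k)) <= 2 * B.
  by apply: le_trans (enormB _ _) _; have := SB k; have := xB k; lra.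
have xE : - (x k.+1 - x k) = alpha k *: (x k - S (x k)) +
    ((1 - alpha k) * beta k) *: (x k - T (x k)) +
    ((1 - alpha k) * (1 - beta k)) *: (x k - W (x k)).
  by rewrite (iterE k); apply/rowP => i; rewrite !mxE; ring.
have : dotp (- (x k.+1 - x k)) (x k - z) <= e1 * beta k * Z.
  apply: le_trans (dotp_le_enorm _ _) _; rewrite enormN.
  by apply: ler_pM; rewrite ?enorm_ge0// ltW.
have w0 : 0 <= (1 - alpha k) * (1 - beta k) * dotp (x k - W (x k)) (x k - z).
  have := residual_monotone Wne (x k) z; rewrite Wz subrr.
  have -> : dotp 0 (x k - z) = 0 by rewrite -(scale0r 0) dotpZl mul0r.
  by move=> ?; rewrite !mulr_ge0// subr_ge0 ltW.
have s2 : - (e1 * beta k * (2 * B * Z)) <= alpha k * dotp (x k - S (x k)) (x k - z).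
  have t1 : enorm (x k - S (x k)) * enorm (x k - z) <= 2 * B * Z.
    by apply: ler_pM; rewrite ?enorm_ge0.
  have := ler_wpM2l (ltW a0) (dotp_ge_Nenorm (x k - S (x k)) (x k - z)).
  apply: le_trans; rewrite mulrN lerN2.
  by apply: ler_pM; rewrite ?(ltW a0)// mulr_ge0 ?enorm_ge0.
have dotpDDl a b d v : dotp (a + b + d) v = dotp a v + dotp b v + dotp d v :> R.
  by rewrite !dotpDl.
rewrite xE dotpDDl !dotpZl => main.
rewrite -(opprB (x k) z) dotpNr ltrN2.
move: w0 s2 main; move: (dotp (x k - T (x k)) _) => p.
move: (dotp (x k - S (x k)) _) (_ * dotp (x k - W (x k)) _) => q r r0 s2 main.
have bp : beta k * ((1 - alpha k) * p) <= beta k * (e1 * ((1 + 2 * B) * Z)) by lra.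
rewrite ler_pM2l// in bp.
rewrite ltNge; apply/negP => ep.
have : 2^-1 * p <= (1 - alpha k) * p by rewrite ler_wpM2r//; lra.
nra.
Unshelve. all: by end_near. Qed.

Lemma cluster_in_vi p : fixpts W !=set0 ->
  (forall e N, 0 < e -> exists2 k, (N <= k)%N & enorm (x k - p) < e) ->
  vi_solutions T W p.
Proof.
move=> Wn0 Hp; apply: vi_solutions_closed => // e z e0 Wz.
have C0 : 0 < 1 + 4 * B by rewrite addr_gt0// mulr_gt0.
have e'0 : 0 < e / (1 + 4 * B) by rewrite divr_gt0.
have bs := beta_small e'0; have tr := T_residual e0 Wz.
have [N _ HN] : \forall k \near \oo,
    enorm (x k - W (x k)) < e /\ - e < dotp (x k - T (x k)) (z - x k).
  near=> k; split; last by near: k; exact: tr.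
  apply: (@le_lt_trans _ _ ((1 + 4 * B) * beta k)); first by near: k; exact: W_residual.
  by rewrite mulrC -ltr_pdivlMr//; near: k; exact: bs.
have [k Nk xk] := Hp e N e0.
by have [? ?] := HN k Nk; exists (x k).
Unshelve. all: by end_near. Qed.

(** * Convergence to the solution of the upper-level inequality *)

Section Limit.
Variable xs : 'rV[R]_n.
Hypothesis Oxs : vi_solutions T W xs.
Hypothesis VIxs : forall z, vi_solutions T W z -> 0 <= dotp (xs - S xs) (z - xs).

Lemma limsup_dotp_le0 e : 0 < e -> \forall k \near \oo, dotp (S xs - xs) (x k - xs) < e.
Proof.
move=> e0; apply: contrapT => nP.
(* If the bound fails infinitely often, a cluster point [p] of the failing indices lies in Omega,
   and [VIxs] at [p] contradicts the failure. *)
have [|p Hp] := @bounded_cluster_seq _ _ x B (fun k => e <= dotp (S xs - xs) (x k - xs)) xB.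
  move=> N; apply: contrapT => nE; apply: nP; exists N => // k /= Nk.
  by rewrite ltNge; apply/negP => ek; apply: nE; exists k.
have Op : vi_solutions T W p.
  apply: cluster_in_vi; first by exists xs; exact: Oxs.1.
  by move=> e' N /(Hp e' N)[k [Nk _ xk]]; exists k.
have q0 : 0 < enorm (S xs - xs) + 1 by rewrite ltr_wpDl ?enorm_ge0.
have d0 : 0 < e / (enorm (S xs - xs) + 1) by rewrite divr_gt0.
have [k [_ ek xk]] := Hp _ 0%N d0.
have := VIxs Op; rewrite -(opprB (S xs)) dotpNl => H.
have E : dotp (S xs - xs) (x k - xs) = dotp (S xs - xs) (x k - p) + dotp (S xs - xs) (p - xs).
  by rewrite -dotpDr addrA subrK.
rewrite E in ek.
have := dotp_le_enorm (S xs - xs) (x k - p).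
have : enorm (S xs - xs) * enorm (x k - p) <= enorm (S xs - xs) * (e / (enorm (S xs - xs) + 1)).
  by rewrite ler_wpM2l ?enorm_ge0// ltW.
have : (enorm (S xs - xs) + 1) * (e / (enorm (S xs - xs) + 1)) = e.
  by rewrite mulrC divfK// gt_eqF.
lra.
Qed.

(** For [p] fixed by [W], the inequality at [xs] allows [xs] to be replaced by [p] in [y - xs]; then
    take the infimum over [p]. *)
Lemma dotp_le_vdist y :
  dotp (T xs - xs) (y - xs) <= enorm (T xs - xs) * vdist y (fixpts W).
Proof.
have [Wxs Hxs] := Oxs.
have step p : fixpts W p -> dotp (T xs - xs) (y - xs) <= enorm (T xs - xs) * enorm (y - p).
  move=> Wp; apply: le_trans (dotp_le_enorm _ _).
  have := Hxs p Wp; rewrite -(opprB (T xs)) dotpNl.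
  have -> : dotp (T xs - xs) (y - xs) = dotp (T xs - xs) (y - p) + dotp (T xs - xs) (p - xs).
    by rewrite -dotpDr addrA subrK.
  lra.
have [Q0|Q0] := eqVneq (enorm (T xs - xs)) 0.
  by have := step _ Wxs; rewrite Q0 !mul0r.
have Qp : 0 < enorm (T xs - xs) by rewrite lt0r Q0 enorm_ge0.
rewrite -ler_pdivrMl//; apply: lb_le_inf; first by exists (enorm (y - xs)), xs.
by move=> _ [p Wp <-]; rewrite ler_pdivrMl//; exact: step.
Qed.

Lemma iteration_converges theta : 0 < theta ->
  (forall z, enorm z <= B -> vdist z (fixpts W) <= theta * enorm (z - W z)) ->
  (fun k => enorm (x k - xs)) @ \oo --> 0.
Proof.
move=> th0 reg.
suff H e : 0 < e -> \forall k \near \oo, enorm (x k - xs) ^+ 2 < e.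
  apply/cvgrPdist_le => e e0; have := H (e ^+ 2) (exprn_gt0 2 e0).
  apply: filterS => k; rewrite sub0r normrN ger0_norm ?enorm_ge0//.
  by rewrite ltr_pXn2r ?nnegrE ?enorm_ge0 ?(ltW e0)// => /ltW.
move: e; apply: (xu_lemma c01 al01 sum_alpha) => e e0.
pose Q := enorm (T xs - xs).
have Q0 : 0 <= Q := enorm_ge0 _.
(* [C * beta k] bounds the [W] residual at [x k.+1]: [(1 + 4 * B) * beta k] from [x k], plus twice
   the increment. *)
pose C := 3 + 4 * B.
have C0 : 0 < C by rewrite addr_gt0// mulr_gt0.
have QC0 : 0 <= Q * (theta * C) by rewrite !mulr_ge0// ltW.
have e40 : 0 < e / 4 by rewrite divr_gt0.
have e1_0 : 0 < e / 4 / (Q * (theta * C) + 1) by rewrite divr_gt0// ltr_wpDl.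
have b2 := beta_sqr e1_0; have Db := D_beta ltr01.
have ls := near_shift (limsup_dotp_le0 e40).
near=> k.
have h1 : dotp (S xs - xs) (x k.+1 - xs) < e / 4 by near: k; exact: ls.
have h2 : beta k ^+ 2 <= e / 4 / (Q * (theta * C) + 1) * alpha k by near: k; exact: b2.
have h3 : D k < 1 * beta k by near: k; exact: Db.
have h4 : enorm (x k - W (x k)) <= (1 + 4 * B) * beta k by near: k; exact: W_residual.
have [/andP[a0 a1] /andP[b0 b1]] := (al01 k, be01 k).
have na : 0 <= 1 - alpha k by rewrite subr_ge0 ltW.
have nb : 0 <= 1 - beta k by rewrite subr_ge0 ltW.
have Wxs : W xs = xs := Oxs.1.
(* [u] is the contracted error and [v] the drift of [xs] under one step; [v] has no [W] term because
   [W xs = xs]. *)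
pose u := alpha k *: (S (x k) - S xs) + (1 - alpha k) *:
   (beta k *: (T (x k) - T xs) + (1 - beta k) *: (W (x k) - W xs)).
pose v := alpha k *: (S xs - xs) + ((1 - alpha k) * beta k) *: (T xs - xs).
have xE : x k.+1 - xs = u + v.
  rewrite /u /v Wxs (iterE k).
  move: (S (x k)) (T (x k)) (W (x k)) (S xs) (T xs) => s t w s' t'.
  by apply/rowP => i; rewrite !mxE; ring.
have c0 := (andP c01).1.
have ca : 0 <= 1 - c * alpha k by have /andP[? ?] := c01; nra.
have ule : enorm u <= (1 - c * alpha k) * enorm (x k - xs).
  apply: le_trans (enormD _ _) _; rewrite !enormZ gtr0_norm// ger0_norm//.
  have := enormD (beta k *: (T (x k) - T xs)) ((1 - beta k) *: (W (x k) - W xs)).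
  rewrite !enormZ gtr0_norm// ger0_norm//.
  have t1 := ler_wpM2l (ltW b0) (Tne (x k) xs).
  have t2 := ler_wpM2l nb (Wne (x k) xs).
  have t3 := ler_wpM2l (ltW a0) (Sc (x k) xs).
  move=> t4; have t5 := ler_wpM2l na (le_trans t4 (lerD t1 t2)); lra.
have usq : enorm u ^+ 2 <= (1 - c * alpha k) * enorm (x k - xs) ^+ 2.
  apply: (@le_trans _ _ (((1 - c * alpha k) * enorm (x k - xs)) ^+ 2)).
    by rewrite lerXn2r ?nnegrE ?mulr_ge0 ?enorm_ge0.
  rewrite exprMn ler_wpM2r ?sqr_ge0// expr2 ler_piMl//.
  by rewrite lerBlDr lerDl mulr_ge0// ltW.
have Tpart : dotp (T xs - xs) (x k.+1 - xs) <= Q * (theta * (C * beta k)).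
  apply: le_trans (dotp_le_vdist _) _; rewrite ler_wpM2l//.
  apply: le_trans (reg _ (xB _)) _; rewrite ler_pM2l//.
  have -> : x k.+1 - W (x k.+1) = (x k - W (x k)) +
      ((x k.+1 - x k) - (W (x k.+1) - W (x k))).
    by apply/rowP => i; rewrite !mxE; ring.
  apply: le_trans (enormD _ _) _.
  have := enormB (x k.+1 - x k) (W (x k.+1) - W (x k)).
  have := Wne (x k.+1) (x k); rewrite -/(D k) /C; lra.
have bT : (1 - alpha k) * beta k * dotp (T xs - xs) (x k.+1 - xs) <= alpha k * (e / 4).
  apply: (@le_trans _ _ ((1 - alpha k) * beta k * (Q * (theta * (C * beta k))))).
    by rewrite ler_wpM2l// mulr_ge0// ltW.
  have -> : (1 - alpha k) * beta k * (Q * (theta * (C * beta k))) =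
     (1 - alpha k) * ((Q * (theta * C)) * beta k ^+ 2) by ring.
  apply: (@le_trans _ _ ((Q * (theta * C) + 1) * beta k ^+ 2)).
    have := mulr_ge0 QC0 (sqr_ge0 (beta k)); have := sqr_ge0 (beta k); nra.
  have X0 : 0 < Q * (theta * C) + 1 by rewrite ltr_wpDl.
  apply: le_trans (ler_wpM2l (ltW X0) h2) _.
  by rewrite le_eqVlt; apply/orP; left; apply/eqP; field; rewrite gt_eqF.
have := enormD_sqr_le u v; rewrite -xE /v dotpDl !dotpZl => m2.
(* The [S] and [T] drifts are each at most [alpha k * (e / 4)]; doubled, they sum to
   [alpha k * e]. *)
have m1 := ler_wpM2l (ltW a0) (ltW h1). lra.
Unshelve. all: by end_near. Qed.

End Limit.
End Iteration.

(** * Existence, uniqueness and minimality of the limit in the trilevel setting *)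

Unset Implicit Arguments.

Theorem mainTheorem7 (R : realType) (n : nat)
  (f1 f2 : 'rV[R]_n -> R) (gf1 gf2 : 'rV[R]_n -> 'rV[R]_n) (Lf1 Lf2 : R)
  (g1 g2 : 'rV[R]_n -> \bar R)
  (om : 'rV[R]_n -> R) (gom : 'rV[R]_n -> 'rV[R]_n) (mu Lom : R)
  (u t s : R)
  (prox1 prox2 : 'rV[R]_n -> 'rV[R]_n)
  (alpha beta : nat -> R) (x : nat -> 'rV[R]_n) :
  (* smooth convex parts *)
  convex_fun f1 -> convex_fun f2 ->
  has_gradient f1 gf1 -> has_gradient f2 gf2 ->
  0 < Lf1 -> 0 < Lf2 -> lipschitz_with gf1 Lf1 -> lipschitz_with gf2 Lf2 ->
  (* nonsmooth parts: proper, lsc, convex *)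
  proper_fun g1 -> proper_fun g2 ->
  lower_semicontinuous g1 -> lower_semicontinuous g2 ->
  convex_efun g1 -> convex_efun g2 ->
  (* strongly convex omega *)
  0 < mu -> strongly_convex_fun om mu -> has_gradient om gom ->
  0 < Lom -> lipschitz_with gom Lom ->
  (* Y* and X* nonempty *)
  let phi1 := fun y => ((f1 y)%:E + g1 y)%E in
  let phi2 := fun y => ((f2 y)%:E + g2 y)%E in
  let Ystar := argmin_on setT phi2 in
  let Xstar := argmin_on Ystar phi1 in
  Ystar !=set0 -> Xstar !=set0 ->
  (* step sizes *)
  0 < u <= 2 / (Lom + mu) -> 0 < t <= 1 / Lf1 -> 0 < s <= 1 / Lf2 ->
  (* prox operators *)
  (forall z, is_prox (fun y => (t%:E * g1 y)%E) z (prox1 z)) ->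
  (forall z, is_prox (fun y => (s%:E * g2 y)%E) z (prox2 z)) ->
  let S := fun z : 'rV[R]_n => z - u *: gom z in
  let T := fun z : 'rV[R]_n => prox1 (z - t *: gf1 z) in
  let W := fun z : 'rV[R]_n => prox2 (z - s *: gf2 z) in
  let Omega := [set z | fixpts W z /\
                  forall y, fixpts W y -> 0 <= dotp (z - T z) (y - z)] in
  Omega !=set0 ->
  (* parameter sequences *)
  (forall k, 0 < alpha k < 1) -> (forall k, 0 < beta k < 1) ->
  (fun k => beta k / alpha k) @ \oo --> +oo ->
  alpha @ \oo --> 0 ->
  (fun N => \sum_(0 <= k < N) alpha k) @ \oo --> +oo ->
  (exists K : R, 0 < K /\
     (limn_esup (fun k => (`|(beta k.+1)^-1 - (beta k)^-1| / alpha k.+1)%:E)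
        <= K%:E)%E) ->
  limn_esup (fun k => ((`|beta k.+1 - beta k| + `|alpha k.+1 - alpha k|)
                        / (alpha k.+1 * beta k.+1))%:E) = 0%E ->
  (* trilevel iteration, bounded *)
  (forall k, x k.+1 = alpha k *: S (x k) + ((1 - alpha k) * beta k) *: T (x k)
                      + ((1 - alpha k) * (1 - beta k)) *: W (x k)) ->
  (exists M : R, forall k, enorm (x k) <= M) ->
  (* (A1) bounded linear regularity of W *)
  (forall rho : R, 0 < rho -> exists theta : R, 0 < theta /\
     forall z, enorm z <= rho -> vdist z (fixpts W) <= theta * enorm (z - W z)) ->
  (* (A2) *)
  limn_esup (fun k => ((beta k) ^+ 2 / alpha k)%:E) = 0%E ->
  exists xs, [/\ Omega xs,
    (forall z, Omega z -> 0 <= dotp (xs - S xs) (z - xs)),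
    (forall y, Omega y -> (forall z, Omega z -> 0 <= dotp (y - S y) (z - y)) ->
               y = xs),
    (forall z, Omega z -> om xs <= om z) &
    (fun k => enorm (x k - xs)) @ \oo --> 0].
Proof.
move=> f1c f2c f1g f2g Lf10 Lf20 gf1L gf2L g1p g2p _ _ g1c g2c mu0 omc omg Lom0 gomL.
move=> phi1 phi2 Ystar Xstar _ _ u01 t01 s01 prox1P prox2P S T W Omega Omega0.
move=> al01 be01 ba al0 sumal [K [K0 HK]] ratio iterE [M xM] reg A2.
have Tne : nonexpansive T.
  exact: prox_gradient_nonexpansive Lf10 f1c f1g gf1L g1p g1c t01 prox1P.
have Wne : nonexpansive W.
  exact: prox_gradient_nonexpansive Lf20 f2c f2g gf2L g2p g2c s01 prox2P.
have [c c01 Sc] := gradient_step_contraction mu0 omc Lom0 omg gomL u01.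
have /andP[u0 _] := u01.
(* Since [u > 0], the inequality for [I - S] is the first-order optimality condition for [om] on
   [Omega]. *)
have IS z : z - S z = u *: gom z by rewrite /S subKr.
have Oclosed p : (forall e, 0 < e -> exists y, Omega y /\ enorm (y - p) < e) -> Omega p.
  move=> Hp; apply: (vi_solutions_closed Tne Wne).
    by have [z [Wz _]] := Omega0; exists z.
  move=> e z e0 Wz; have [y [[Wy Hy] yp]] := Hp e e0; exists y; split=> //.
    by rewrite Wy subrr enorm0.
  by apply: lt_le_trans (Hy z Wz); rewrite oppr_lt0.
have [xs Oxs xsmin] := strongly_convex_argmin mu0 omc omg gomL Omega0 Oclosed.
have gvi := argmin_gradient_vi omg gomL (vi_solutions_convex Tne Wne) Oxs xsmin.
have vi z : Omega z -> 0 <= dotp (xs - S xs) (z - xs).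
  by move=> Oz; rewrite IS dotpZl mulr_ge0 ?(ltW u0)//; exact: gvi.
exists xs; split => //.
  move=> y Oy Hy; apply/subr0_eq/enorm_eq0/eqP; rewrite -sqrf_eq0 eq_le sqr_ge0 andbT.
  rewrite -(pmulr_rle0 _ mu0).
  (* Uniqueness: the inequalities at [y] and [xs], tested against each other, add up to a
     nonpositive upper bound here. *)
  apply: le_trans (strongly_monotone_gradient y xs omc omg gomL) _.
  have := Hy xs Oxs; rewrite IS dotpZl pmulr_rge0// => H.
  have := gvi y Oy; rewrite -(opprB y xs) dotpNr in H *.
  rewrite dotpDl dotpNl; lra.
have bnd F (l : R) : lipschitz_with F l -> l <= 1 -> forall k, enorm (F (x k)) <= M + enorm (F 0).
  move=> FL l1 k; rewrite -{1}(subrK (F 0) (F (x k))).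
  apply: le_trans (enormD _ _) _; rewrite lerD2r.
  apply: le_trans (FL _ _) _; rewrite subr0.
  by apply: le_trans (xM k); rewrite ler_piMl ?enorm_ge0.
pose B := `|M| + enorm (S 0) + enorm (T 0) + enorm (W 0) + 1.
have MB := ler_norm M.
have [S0 T0 W0] : [/\ 0 <= enorm (S 0), 0 <= enorm (T 0) & 0 <= enorm (W 0)].
  by split; exact: enorm_ge0.
have B0 : 0 < B by rewrite /B; have := normr_ge0 M; lra.
have [theta [theta0 Hth]] := reg B B0.
have near_le (v : nat -> R) e : limn_esup (fun k => (v k)%:E) = 0%E -> 0 < e ->
    \forall k \near \oo, v k < e.
  by move=> v0 e0; apply: limn_esup_near_lt; rewrite v0 lte_fin.
have c1 : 1 - c <= 1 by have /andP[? _] := c01; lra.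
have T1 : lipschitz_with T 1 by move=> y z; rewrite mul1r; exact: Tne.
have W1 : lipschitz_with W 1 by move=> y z; rewrite mul1r; exact: Wne.
(* [K + 1] makes the limsup bound strict, so that it holds for all large indices. *)
apply: (@iteration_converges R n S T W c (K + 1) alpha beta x c01 Sc Tne Wne
  al01 be01 ba sumal _ _ _ _ iterE B B0 _ _ _ _ xs Oxs vi theta theta0 Hth).
- by rewrite addr_gt0.
- have : (limn_esup (fun k => (`|(beta k.+1)^-1 - (beta k)^-1| / alpha k.+1)%:E)
        < (K + 1)%:E)%E by apply: le_lt_trans HK _; rewrite lte_fin ltrDl.
  move/limn_esup_near_lt; apply: filterS => k.
  by rewrite ltr_pdivrMr ?(andP (al01 _)).1// => /ltW.
- move=> e e0; have := near_le _ _ ratio e0; apply: filterS => k.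
  by rewrite ltr_pdivrMr ?mulr_gt0 ?(andP (al01 _)).1 ?(andP (be01 _)).1// => /ltW.
- move=> e e0; have := near_le _ _ A2 e0; apply: filterS => k.
  by rewrite ltr_pdivrMr ?(andP (al01 _)).1// => /ltW.
- by move=> k; apply: le_trans (xM k) _; rewrite /B; lra.
- by move=> k; apply: le_trans (bnd _ _ Sc c1 k) _; rewrite /B; lra.
- by move=> k; apply: le_trans (bnd _ _ T1 (lexx _) k) _; rewrite /B; lra.
- by move=> k; apply: le_trans (bnd _ _ W1 (lexx _) k) _; rewrite /B; lra.
Qed.
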